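(* Let $a,b,c$ be non-negative real numbers with $a+b+c=1$, and let $E(m_n(a,b,c))$ be the expected value of the number of matchings of the random hexagonal cactus $R_n(a,b,c)$. Put \[\sigma_1=\sqrt{9a^2+30ab+24ac+152a+25b^2+40bc+40b+16c^2+96c+64},\qquad \sigma_2=46a-30b+8c+30ab+24ac+40bc.\] Then, as $n\to\infty$, \[ E(m_n(a,b,c))\approx \frac{\frac{1}{(1/4)^{n+1}}\left(\sigma_2-3a\sigma_1-5b\sigma_1-4c\sigma_1+9a^2+25b^2+16c^2+10\sigma_1-80\right)}{\left(-\frac{3a+5b+4c-\sigma_1+8}{13a-5b+4c}\right)^{n+1}(52a-20b+16c)\,\sigma_1}, \] where $\approx$ means asymptotic equivalence (the ratio of the two sides tends to $1$).
   Context: A matching of a graph is a set of edges no two of which share a vertex (the empty set counts as a matching). A hexagon is a cycle $C_6$. The random hexagonal cactus $R_n(a,b,c)$, for non-negative reals $a,b,c$ with $a+b+c=1$, is defined recursively: $R_0(a,b,c)$ is the empty graph; $R_1(a,b,c)$ is a hexagon; $R_2(a,b,c)$ is obtained from two hexagons by identifying one vertex of one with one vertex of the other. For $n\ge 3$, label the hexagons of $R_{n-1}(a,b,c)$ as $1,\dots,n-1$ consecutively along the chain; the $(n-1)$-th hexagon contains a cut vertex $v$ (shared with the $(n-2)$-th hexagon). Then $R_n(a,b,c)$ is obtained from $R_{n-1}(a,b,c)$ and a new hexagon $H$ by identifying a vertex of $H$ with a vertex of the $(n-1)$-th hexagon that is at distance one from $v$ with probability $a$, at distance two from $v$ with probability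 $b$, or at distance three from $v$ with probability $c$ (distances measured in the $(n-1)$-th hexagon), independently at each step.
   Formalization: The formal statement adds the assumption 13a−5b+4c ≠ 0, since otherwise (e.g. a=5/18, b=13/18, c=0) the displayed right-hand side divides by zero and is undefined. *)

(* Defs.v *)
From HB Require Import structures.
From mathcomp Require Import all_boot all_order all_algebra.
From mathcomp Require Import reals.

Set Implicit Arguments.
Unset Strict Implicit.
Unset Printing Implicit Defensive.

Import Order.TTheory GRing.Theory Num.Theory.
Local Open Scope ring_scope.

Record sgraph := SGraph {
  svertex :> finType;
  sedge : rel svertex;
  sedge_sym : symmetric sedge;
  sedge_irr : irreflexive sedge }.

Definition edges (G : sgraph) : {set {set G}} :=
  [set e | [exists x, exists y, sedge x y && (e == [set x; y])]].

Definition is_matching (G : sgraph) (M : {set {set G}}) : bool :=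
  (M \subset edges G) && trivIset M.

Definition num_matchings (G : sgraph) : nat :=
  #|[set M : {set {set G}} | is_matching M]|.

Definition void_rel : rel void := fun _ _ => false.

Lemma void_rel_sym : symmetric void_rel. Proof. by case. Qed.
Lemma void_rel_irr : irreflexive void_rel. Proof. by case. Qed.

Definition empty_graph : sgraph := SGraph void_rel_sym void_rel_irr.

Definition hex_rel : rel 'I_6 := fun i j => (ordS i == j) || (ordS j == i).

Lemma hex_rel_sym : symmetric hex_rel.
Proof. by move=> i j; rewrite /hex_rel orbC. Qed.

Lemma hex_rel_irr : irreflexive hex_rel.
Proof. by case=> [[|[|[|[|[|[|i]]]]]] Hi]. Qed.

Definition hexagon : sgraph := SGraph hex_rel_sym hex_rel_irr.

(* A vertex of a new hexagon is identified with the vertex u of G. By symmetry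
   the vertex 0 of the new hexagon is the one identified with u; its other
   vertices lift ord0 j, j : 'I_5, become inr j. *)
Section Attach.
Variables (G : sgraph) (u : G).

Definition attach_rel : rel (G + 'I_5)%type := fun x y =>
  match x, y with
  | inl x, inl y => sedge x y
  | inl x, inr j => (x == u) && hex_rel ord0 (lift ord0 j)
  | inr i, inl y => (y == u) && hex_rel (lift ord0 i) ord0
  | inr i, inr j => hex_rel (lift ord0 i) (lift ord0 j)
  end.

Lemma attach_rel_sym : symmetric attach_rel.
Proof. by case=> [x|i] [y|j] /=; rewrite 1?sedge_sym 1?hex_rel_sym. Qed.

Lemma attach_rel_irr : irreflexive attach_rel.
Proof. by case=> [x|i] /=; rewrite ?sedge_irr ?hex_rel_irr. Qed.

Definition attach_hexagon : sgraph := SGraph attach_rel_sym attach_rel_irr.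

Definition attached_hex (i : 'I_6) : attach_hexagon :=
  if unlift ord0 i is Some j then inr j else inl u.

End Attach.

(* A cactus chain with its last hexagon marked: last_hex lists the vertices of
   that hexagon in cyclic order, and, when there are at least two hexagons,
   last_hex ord0 is the cut vertex shared with the previous hexagon. Hence
   last_hex p is at distance min(p, 6 - p) from the cut vertex. *)
Record chain := Chain {
  chain_graph : sgraph;
  last_hex : 'I_6 -> chain_graph }.

Definition chain1 : chain := @Chain hexagon id.

Definition extend (C : chain) (p : 'I_6) : chain :=
  Chain (@attached_hex (chain_graph C) (last_hex C p)).

(* d : 'I_3 stands for the distance d + 1. For the distances one and two there
   are two candidate vertices, exchanged by a reflection of the last hexagon
   fixing the cut vertex, i.e., by an automorphism of the whole graph; the
   choice between them does not change the isomorphism type of the result. *)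
Definition extend_at_dist (C : chain) (d : 'I_3) : chain :=
  extend C (inord d.+1).

(* The cactus with n hexagons whose successive random choices are given by w. *)
Definition cactus (n : nat) (w : (n - 2).-tuple 'I_3) : sgraph :=
  match n with
  | 0 => empty_graph
  | 1 => hexagon
  | _ => chain_graph (foldl extend_at_dist (extend chain1 ord0) w)
  end.

Section Expectation.
Variable R : realType.

Definition dist_prob (a b c : R) (d : 'I_3) : R := tnth [tuple a; b; c] d.

Definition choices_prob (a b c : R) (k : nat) (w : k.-tuple 'I_3) : R :=
  \prod_(i < k) dist_prob a b c (tnth w i).

Definition expected_matchings (a b c : R) (n : nat) : R :=
  \sum_(w : (n - 2).-tuple 'I_3)
    choices_prob a b c w * (num_matchings (cactus w))%:R.

Definition sigma1 (a b c : R) : R :=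
  Num.sqrt (9 * a ^+ 2 + 30 * a * b + 24 * a * c + 152 * a + 25 * b ^+ 2
            + 40 * b * c + 40 * b + 16 * c ^+ 2 + 96 * c + 64).

Definition sigma2 (a b c : R) : R :=
  46 * a - 30 * b + 8 * c + 30 * a * b + 24 * a * c + 40 * b * c.

Definition asymptotic_value (a b c : R) (n : nat) : R :=
  let s1 := sigma1 a b c in
  let s2 := sigma2 a b c in
  (1 / (1 / 4) ^+ n.+1 *
    (s2 - 3 * a * s1 - 5 * b * s1 - 4 * c * s1
     + 9 * a ^+ 2 + 25 * b ^+ 2 + 16 * c ^+ 2 + 10 * s1 - 80))
  / ((- ((3 * a + 5 * b + 4 * c - s1 + 8) / (13 * a - 5 * b + 4 * c))) ^+ n.+1
     * (52 * a - 20 * b + 16 * c) * s1).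

End Expectation.

(* Main.v *)
Require Import Defs.
From HB Require Import structures.
From mathcomp Require Import all_boot all_order all_algebra.
From mathcomp Require Import zify ring lra reals.

(* Let m be the number of matchings of a chain and m' the number of those that
   miss the next attachment vertex. Splitting the matchings of the enlarged
   chain by their trace on the new hexagon, m becomes 8 m + 10 m', and m' becomes
   5 m + 3 m', 3 m + 5 m' or 4 m + 4 m' when the following attachment vertex is at
   distance one, two or three. Taking expectations gives a linear recurrence
   with a 2 x 2 matrix whose eigenvalues are (8 + t + sigma1) / 2 and
   (8 + t - sigma1) / 2, where t = 3 a + 5 b + 4 c; the first one strictly
   dominates the second in absolute value. *)

Set Implicit Arguments.
Unset Strict Implicit.
Unset Printing Implicit Defensive.

Import Order.TTheory GRing.Theory Num.Theory.

(** * Set families under injective maps, and sums over tuples *)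

Lemma imset_set2 (T T' : finType) (g : T -> T') (x y : T) :
  g @: [set x; y] = [set g x; g y].
Proof. by rewrite imsetU1 imset_set1. Qed.

Lemma disjoint_imset_inj (T T' : finType) (g : T -> T') (A B : {set T}) :
  injective g -> [disjoint g @: A & g @: B] = [disjoint A & B].
Proof. by move=> g_inj; rewrite -!setI_eq0 -imsetI ?imset_eq0 // => x y _ _ /g_inj. Qed.

Lemma cover_imset (T T' : finType) (g : T -> T') (P : {set {set T}}) :
  cover [set g @: (A : {set T}) | A in P] = g @: cover P.
Proof.
apply/setP => x; apply/bigcupP/imsetP => [[_ /imsetP[A AP ->]]|[y /bigcupP[A AP yA] ->]].
  by case/imsetP => y yA ->; exists y => //; apply/bigcupP; exists A.
by exists (g @: A); rewrite imset_f.
Qed.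

Lemma trivIset_imset_inj (T T' : finType) (g : T -> T') (P : {set {set T}}) :
  injective g -> trivIset [set g @: (A : {set T}) | A in P] = trivIset P.
Proof.
move=> g_inj; apply/trivIsetP/trivIsetP => tP A B.
  move=> AP BP AB; rewrite -(disjoint_imset_inj _ _ g_inj).
  by apply: tP; rewrite ?imset_f // (inj_eq (imset_inj g_inj)).
move=> /imsetP[A' AP ->] /imsetP[B' BP ->]; rewrite (inj_eq (imset_inj g_inj)) => AB.
by rewrite disjoint_imset_inj // tP.
Qed.

Lemma disjoint_cover (T : finType) (P Q : {set {set T}}) A B :
  A \in P -> B \in Q -> [disjoint cover P & cover Q] -> [disjoint A & B].
Proof.
move=> AP BQ; apply: disjointW; apply/subsetP => x ?; apply/bigcupP; [by exists A|by exists B].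
Qed.

Lemma big_tuple_cons (S : Type) (idx : S) (op : Monoid.com_law idx)
    (T : finType) (n : nat) (F : n.+1.-tuple T -> S) :
  \big[op/idx]_t F t = \big[op/idx]_x \big[op/idx]_(t : n.-tuple T) F [tuple of x :: t].
Proof.
rewrite pair_big /= (reindex (fun p : T * n.-tuple T => [tuple of p.1 :: p.2])) //=.
exists (fun t : n.+1.-tuple T => (thead t, [tuple of behead t])) => [[x t] _|t _] /=.
  by rewrite theadE; congr (_, _); apply: val_inj.
by rewrite -tuple_eta.
Qed.

Lemma big_tuple0 (S : Type) (idx : S) (op : Monoid.com_law idx)
    (T : finType) (F : 0.-tuple T -> S) : \big[op/idx]_t F t = F [tuple].
Proof.
rewrite (eq_bigr (fun=> F [tuple])) => [|t _]; last by rewrite tuple0.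
by rewrite big_const card_tuple /= Monoid.mulm1.
Qed.

(** An explicit list, so that a sum over [n.-tuple bool] unfolds to closed terms and can be
    evaluated by computation. *)
Fixpoint bitseqs (n : nat) : seq bitseq :=
  if n is m.+1 then map (cons true) (bitseqs m) ++ map (cons false) (bitseqs m)
  else [:: [::]].

Lemma big_bool_tuple (n : nat) (F : bitseq -> nat) :
  \sum_(t : n.-tuple bool) F t = \sum_(s <- bitseqs n) F s.
Proof.
elim: n F => [|n IHn] F; first by rewrite big_tuple0 big_seq1.
rewrite big_tuple_cons big_bool /= big_cat !big_map /=.
by congr (_ + _); rewrite -IHn.
Qed.

(** * Matchings that leave a vertex set uncovered *)

Definition avoiding_matchings (G : sgraph) (A : {set G}) : nat :=
  #|[set M : {set {set G}} | is_matching M & [disjoint A & cover M]]|.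

(** Since a whole set is avoided rather than one vertex, the same gluing formula yields both m
    (avoid nothing) and m' (avoid one vertex). *)
Lemma num_matchings_avoiding0 (G : sgraph) :
  num_matchings G = avoiding_matchings (@set0 G).
Proof.
by apply: eq_card => M; rewrite !inE -setI_eq0 set0I eqxx andbT.
Qed.

Lemma card_edge (G : sgraph) (e : {set G}) : e \in edges G -> #|e| = 2.
Proof.
rewrite inE => /existsP[x /existsP[y /andP[xy /eqP->]]].
by rewrite cards2; case: eqP xy => // ->; rewrite sedge_irr.
Qed.

(** * Matchings of two graphs glued at one vertex *)

Section Wedge.
Variables (G H K : sgraph) (f : G -> K) (h : H -> K) (u : G) (w : H).
Hypotheses (f_inj : injective f) (h_inj : injective h) (fu : f u = h w).
Hypothesis fh : forall x y, f x = h y -> x = u /\ y = w.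
Hypothesis edgesK : edges K =
  [set f @: e | e : {set G} in edges G] :|: [set h @: e | e : {set H} in edges H].

Definition wedge_matching (MN : {set {set G}} * {set {set H}}) : {set {set K}} :=
  [set f @: e | e : {set G} in MN.1] :|: [set h @: e | e : {set H} in MN.2].

(** The two images share only the glued vertex, whereas an edge has two vertices. *)
Lemma wedge_edge_neq (e : {set G}) (e' : {set H}) :
  e \in edges G -> f @: e <> h @: e'.
Proof.
move=> /card_edge e2 E; suff: #|e| <= 1 by rewrite e2.
rewrite -(cards1 u); apply/subset_leq_card/subsetP => x xe.
have : f x \in h @: e' by rewrite -E imset_f.
by case/imsetP => y _ /fh[-> _]; rewrite inE.
Qed.

Lemma mem_wedgel (M : {set {set G}}) (N : {set {set H}}) (e : {set G}) :
  e \in edges G -> M \subset edges G ->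
  (f @: e \in wedge_matching (M, N)) = (e \in M).
Proof.
move=> eG sM; rewrite inE mem_imset /=; last exact: imset_inj.
by case: imsetP => [[e' _ /(wedge_edge_neq eG)]//|]; rewrite orbF.
Qed.

Lemma mem_wedger (M : {set {set G}}) (N : {set {set H}}) (e : {set H}) :
  M \subset edges G ->
  (h @: e \in wedge_matching (M, N)) = (e \in N).
Proof.
move=> sM; rewrite inE orbC mem_imset /=; last exact: imset_inj.
case: imsetP => [[e' /(subsetP sM) e'G /esym /(wedge_edge_neq e'G)]//|].
by rewrite orbF.
Qed.

(** The restriction to sets of edges matters: [set0], or the singletons of [u] and [w], have the
    same image from both sides. *)
Lemma wedge_matching_inj :
  {in [pred MN : {set {set G}} * {set {set H}} |
       (MN.1 \subset edges G) && (MN.2 \subset edges H)] &,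
    injective wedge_matching}.
Proof.
move=> [M N] [M' N'] /andP[/= sM sN] /andP[/= sM' sN'] E.
congr (_, _); apply/setP => e.
  have [eG|eG] := boolP (e \in edges G).
    by rewrite -(mem_wedgel N eG sM) E mem_wedgel.
  by rewrite !(contraNF (subsetP _ e) eG).
by rewrite -(mem_wedger N e sM) E mem_wedger.
Qed.

Lemma wedge_matching_surj (L : {set {set K}}) : L \subset edges K ->
  exists (M : {set {set G}}) (N : {set {set H}}),
    [/\ M \subset edges G, N \subset edges H & L = wedge_matching (M, N)].
Proof.
move=> sL; exists [set e in edges G | f @: e \in L], [set e in edges H | h @: e \in L].
split; try by apply/subsetP => e; rewrite inE => /andP[].
apply/setP => e; apply/idP/idP => [eL|].
  have := subsetP sL _ eL; rewrite edgesK !inE.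
  case/orP => /imsetP[e' e'G ee']; apply/orP; [left|right]; rewrite ee' imset_f //;
  by rewrite inE e'G -ee'.
by rewrite inE => /orP[] /imsetP[e']; rewrite inE => /andP[_ ?] ->.
Qed.

Lemma disjoint_wedge (A : {set G}) (B : {set H}) :
  [disjoint f @: A & h @: B] = ~~ ((u \in A) && (w \in B)).
Proof.
apply/idP/idP => [dAB|].
  apply/negP => /andP[uA wB].
  by have := disjointFr dAB (imset_f f uA); rewrite fu imset_f.
apply: contraR => /pred0Pn[x /andP[/imsetP[y yA ->] /imsetP[z zB /fh[<- <-]]]].
by rewrite yA zB.
Qed.

(** Edges from different sides can meet only at the glued vertex, so the only new conflict is that
    both sides cover it. *)
Lemma is_matching_wedge (M : {set {set G}}) (N : {set {set H}}) :
  M \subset edges G -> N \subset edges H ->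
  is_matching (wedge_matching (M, N)) =
  [&& is_matching M, is_matching N & ~~ ((u \in cover M) && (w \in cover N))].
Proof.
move=> sM sN; rewrite /is_matching sM sN /=.
have -> : wedge_matching (M, N) \subset edges K.
  by rewrite edgesK setUSS //= imsetS.
rewrite -disjoint_wedge -!cover_imset -(trivIset_imset_inj M f_inj).
rewrite -(trivIset_imset_inj N h_inj) /=.
apply/idP/and3P => [tMN|[tM tN dMN]].
  split; [exact: trivIsetS (subsetUl _ _) tMN|exact: trivIsetS (subsetUr _ _) tMN|].
  rewrite !cover_imset disjoint_wedge; apply/negP => /andP[/bigcupP[e eM ue] /bigcupP[e' eN we']].
  have eG := subsetP sM _ eM.
  have /trivIsetP/(_ (f @: e) (h @: e')) := tMN.
  rewrite mem_wedgel // mem_wedger // disjoint_wedge ue we'.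
  by move=> /(_ eM eN); case: eqP => [/(wedge_edge_neq eG)//|_ /(_ isT)].
apply/trivIsetP => A B; rewrite !inE => /orP[] PA /orP[] PB nAB.
- exact: (trivIsetP tM).
- exact: disjoint_cover dMN.
- by rewrite disjoint_sym; apply: disjoint_cover dMN.
- exact: (trivIsetP tN).
Qed.

Lemma disjoint_cover_wedge (B : {set H}) (M : {set {set G}}) (N : {set {set H}}) :
  [disjoint h @: B & cover (wedge_matching (M, N))] =
  [disjoint B & cover N] && ~~ ((w \in B) && (u \in cover M)).
Proof.
rewrite /wedge_matching /cover bigcup_setU -!/(cover _) !cover_imset /=.
rewrite -setI_eq0 setIUr setU_eq0 !setI_eq0 andbC disjoint_imset_inj //.
by rewrite [X in _ && X]disjoint_sym disjoint_wedge [(u \in _) && _]andbC.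
Qed.

(** Matchings are sorted by their trace [N] on [H]. The trace on [G] must miss [u] exactly when the
    glued vertex is forbidden by [B] or already covered by [N]; otherwise it is arbitrary. *)
Lemma avoiding_matchings_wedge (B : {set H}) :
  avoiding_matchings (h @: B) =
  \sum_(N : {set {set H}} | is_matching N && [disjoint B & cover N])
    (if (w \in B) || (w \in cover N) then avoiding_matchings [set u] else num_matchings G).
Proof.
(* [D] collects the admissible pairs of traces; [wedge_matching] maps it bijectively onto the
   matchings to be counted. *)
pose D := [set MN : {set {set G}} * {set {set H}} |
  [&& is_matching MN.1, is_matching MN.2 && [disjoint B & cover MN.2] &
    ((w \in B) || (w \in cover MN.2)) ==> (u \notin cover MN.1)]].
have sD : {subset D <= [pred MN : {set {set G}} * {set {set H}} |
    (MN.1 \subset edges G) && (MN.2 \subset edges H)]}.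
  by move=> [M N]; rewrite !inE /= => /and3P[/andP[-> _] /andP[/andP[-> _] _] _].
have -> : avoiding_matchings (h @: B) = #|D|.
  rewrite -(card_in_imset (sub_in2 sD wedge_matching_inj)); apply: eq_card => L.
  rewrite inE; apply/idP/imsetP => [/andP[mL dL]|[[M N] MND ->]].
    have /wedge_matching_surj[M [N [sM sN EL]]] := proj1 (andP mL).
    exists (M, N) => //; move: mL dL; rewrite EL is_matching_wedge // disjoint_cover_wedge.
    rewrite inE /= => /and3P[-> -> uw] /andP[-> uB] /=.
    by move: uw uB; case: (w \in B); case: (w \in cover N); case: (u \in cover M).
  have /andP[sM sN] := sD _ MND; move: MND; rewrite inE /= is_matching_wedge //.
  rewrite disjoint_cover_wedge => /and3P[-> /andP[-> ->]].
  by case: (w \in B); case: (w \in cover N); case: (u \in cover M).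
(* The cardinal of [D] is now computed slice by slice, with [N] fixed. *)
rewrite -sum1_card (eq_bigl (fun MN : {set {set G}} * {set {set H}} =>
  true && ((MN.1, MN.2) \in D))); last by case.
rewrite -(pair_big_dep xpredT (fun M N => (M, N) \in D) (fun _ _ => 1)) /=.
rewrite (exchange_big_dep xpredT) //= [RHS]big_mkcond; apply: eq_bigr => N _ /=.
rewrite sum1dep_card.
case: ifP => HN; last first.
  by apply/eqP; rewrite cards_eq0; apply/eqP/setP => M; rewrite !inE /= HN andbF.
case: ifP => Hw; apply: eq_card => M; rewrite !inE /= HN Hw //.
  by rewrite disjoints1.
by rewrite andbT.
Qed.
End Wedge.

(** * Matchings of a single hexagon, encoded by bits *)

Definition hex_edge (i : 'I_6) : {set hexagon} := [set i; ordS i].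

Lemma edges_hexagon : edges hexagon = [set hex_edge i | i : 'I_6].
Proof.
apply/setP => e; rewrite inE; apply/existsP/imsetP => [[x /existsP[y]]|[i _ ->]].
  case/andP => /orP[] /eqP xy /eqP->; [exists x|exists y] => //; rewrite /hex_edge xy //.
  by rewrite setUC.
by exists i; apply/existsP; exists (ordS i); rewrite eqxx /= /hex_rel eqxx.
Qed.

Lemma ordS_neq (i : 'I_6) : (ordS i == i) = false.
Proof. by case: i => [[|[|[|[|[|[|?]]]]]] ?]. Qed.

Lemma ordSS_neq (i : 'I_6) : (ordS (ordS i) == i) = false.
Proof. by case: i => [[|[|[|[|[|[|?]]]]]] ?]. Qed.

(** If i were j + 1, then i + 1 = j + 2 would be j or j + 1, which a cycle of length six
    excludes. *)
Lemma hex_edge_inj : injective hex_edge.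
Proof.
move=> i j Eij; have : i \in hex_edge j by rewrite -Eij !inE eqxx.
have : ordS i \in hex_edge j by rewrite -Eij !inE eqxx orbT.
rewrite !inE => Sij /orP[/eqP//|/eqP Ei]; move: Sij.
by rewrite Ei ordSS_neq ordS_neq.
Qed.

(* Bit i selects the edge {i, i + 1}; [hex_independent] and [hex_covered] below
   are the same encoding on raw bit sequences, so that sums over matchings of
   the hexagon can be evaluated by computation. *)
Definition hex_matching (t : 6.-tuple bool) : {set {set hexagon}} :=
  [set hex_edge i | i : 'I_6 & tnth t i].

Definition hex_independent (s : bitseq) : bool :=
  all (fun i => ~~ (nth false s i && nth false s (i.+1 %% 6))) (iota 0 6).

Definition hex_covered (s : bitseq) (j : nat) : bool :=
  nth false s j || nth false s ((j + 5) %% 6).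

Lemma mem_hex_matching (t : 6.-tuple bool) (i : 'I_6) :
  (hex_edge i \in hex_matching t) = tnth t i.
Proof. by rewrite mem_imset ?inE //; exact: hex_edge_inj. Qed.

Lemma hex_independentP (t : 6.-tuple bool) :
  reflect (forall i : 'I_6, ~~ (tnth t i && tnth t (ordS i))) (hex_independent t).
Proof.
apply: (iffP allP) => [H i|H i].
  by rewrite !(tnth_nth false); apply: (H i); rewrite mem_iota ltn_ord.
by rewrite mem_iota => /= i6; have := H (Ordinal i6); rewrite !(tnth_nth false).
Qed.

Lemma is_matching_hex (t : 6.-tuple bool) :
  is_matching (hex_matching t) = hex_independent t.
Proof.
rewrite /is_matching edges_hexagon imsetS /=; last by apply/subsetP.
apply/trivIsetP/hex_independentP => [H i|H].
  apply/negP => /andP[ti tSi]; have := H (hex_edge i) (hex_edge (ordS i)).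
  rewrite !mem_hex_matching ti tSi (inj_eq hex_edge_inj) eq_sym ordS_neq.
  move=> /(_ isT isT isT)/disjointFr/(_ (_ : ordS i \in _)).
  by rewrite !inE eqxx orbT => /(_ isT).
move=> _ _ /imsetP[i + ->] /imsetP[j + ->]; rewrite !inE => ti tj.
rewrite (inj_eq hex_edge_inj) => ij.
(* Distinct edges of the hexagon meet only if they are consecutive, and two selected edges never
   are. *)
have nS (k l : 'I_6) : tnth t k -> tnth t l -> (ordS k == l) = false.
  by move=> tk tl; apply/eqP => kl; have := H k; rewrite kl tk tl.
rewrite -setI_eq0; apply/eqP/setP => x; rewrite !inE.
apply/negP => /andP[/orP[]/eqP-> /orP[]].
- by rewrite (negPf ij).
- by rewrite eq_sym nS.
- by rewrite nS.
- by rewrite (inj_eq (can_inj (@ordSK _))) (negPf ij).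
Qed.

Lemma mem_cover_hex (t : 6.-tuple bool) (j : 'I_6) :
  (j \in cover (hex_matching t)) = hex_covered t j.
Proof.
have -> : hex_covered t j = tnth t j || tnth t (ord_pred j).
  (* [ord_pred j] has value [(j + 6).-1 %% 6], that is [(j + 5) %% 6]. *)
  by rewrite !(tnth_nth false) /hex_covered /= (addnS j 5).
apply/bigcupP/orP => [[_ /imsetP[i + ->]]|].
  by rewrite !inE => ti /orP[]/eqP->; [left|right; rewrite ordSK].
case=> tj; [exists (hex_edge j)|exists (hex_edge (ord_pred j))];
  by rewrite ?mem_hex_matching // !inE ?ord_predK eqxx ?orbT.
Qed.

Lemma big_hex_matching (F : {set {set hexagon}} -> nat) :
  \sum_(N : {set {set hexagon}} | is_matching N) F N =
  \sum_(t : 6.-tuple bool | hex_independent t) F (hex_matching t).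
Proof.
rewrite (reindex_onto hex_matching
  (fun N : {set {set hexagon}} => [tuple hex_edge i \in N | i < 6])) /=.
  apply: eq_bigl => t; rewrite is_matching_hex andbC.
  by case: eqP => // -[]; apply: eq_from_tnth => i; rewrite tnth_mktuple mem_hex_matching.
move=> N /andP[]; rewrite edges_hexagon => sN _; apply/setP => e.
apply/imsetP/idP => [[i + ->]|eN]; first by rewrite inE tnth_mktuple.
have /imsetP[i _ Ei] := subsetP sN _ eN; exists i => //.
by rewrite inE tnth_mktuple -Ei.
Qed.

(** The gluing formula sees a hexagon matching only through whether it covers vertex 0, the glued
    vertex; hence the summand [F] of a boolean. *)
Lemma sum_hex_matching (B : {set hexagon}) (F : bool -> nat) :
  \sum_(N : {set {set hexagon}} | is_matching N && [disjoint B & cover N])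
     F (@ord0 5 \in cover N) =
  \sum_(t : 6.-tuple bool)
   (if hex_independent t && [forall j in B, ~~ hex_covered t (j : 'I_6)]
    then F (hex_covered t 0) else 0).
Proof.
rewrite big_mkcondr big_hex_matching big_mkcond.
apply: eq_bigr => t _ /=; case: hex_independent => //=; rewrite mem_cover_hex.
congr (if _ then _ else _).
apply/idP/forall_inP => [d j jB|H].
  by rewrite -mem_cover_hex (disjointFr d).
rewrite disjoint_subset; apply/subsetP => j jB.
by rewrite inE mem_cover_hex H.
Qed.

(** Of the 18 matchings of the hexagon, 8 miss vertex 0, being the matchings of a path on five
    vertices, and 10 cover it. *)
Lemma sum_hex_matching0 (F : bool -> nat) :
  \sum_(N : {set {set hexagon}} | is_matching N && [disjoint (@set0 hexagon) & cover N])
     F (@ord0 5 \in cover N) = 8 * F false + 10 * F true.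
Proof.
rewrite sum_hex_matching (eq_bigr (fun t : 6.-tuple bool =>
    if hex_independent t then F (hex_covered t 0) else 0)) => [|t _].
  rewrite (big_bool_tuple _ (fun s =>
    if hex_independent s then F (hex_covered s 0) else 0)).
  by rewrite unlock /hex_covered /=; lia.
congr (if _ then _ else _); rewrite (_ : [forall j in _, _]) ?andbT //.
by apply/forall_inP => j; rewrite inE.
Qed.

(** For p nonzero, deleting vertices 0 and p leaves paths on 0 and 4, 1 and 3, or 2 and 2 vertices,
    with 5, 3 or 4 matchings. The two entries always add up to 8, the number of matchings missing
    p. *)
Lemma sum_hex_matching1 (p : 'I_6) (F : bool -> nat) :
  \sum_(N : {set {set hexagon}} | is_matching N && [disjoint [set p : hexagon] & cover N])
     F (@ord0 5 \in cover N) =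
  nth 0 [:: 8; 5; 3; 4; 3; 5] p * F false + nth 0 [:: 0; 3; 5; 4; 5; 3] p * F true.
Proof.
rewrite sum_hex_matching (eq_bigr (fun t : 6.-tuple bool =>
    if hex_independent t && ~~ hex_covered t p then F (hex_covered t 0) else 0)) => [|t _].
  rewrite (big_bool_tuple _ (fun s =>
    if hex_independent s && ~~ hex_covered s p then F (hex_covered s 0) else 0)).
  by case: p => [[|[|[|[|[|[|?]]]]]] ?] //; rewrite unlock /hex_covered /=; lia.
congr (if _ && _ then _ else _).
apply/forall_inP/idP => [H|H j]; first by apply: H; rewrite inE.
by rewrite inE => /eqP->.
Qed.

(** * Effect of attaching one hexagon *)

Section AttachHexagon.
Variables (G : sgraph) (u : G).
Let h := attached_hex u.

Lemma attached_hex0 : h ord0 = inl u.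
Proof. by rewrite /h /attached_hex unlift_none. Qed.

Lemma attached_hex_lift j : h (lift ord0 j) = inr j.
Proof. by rewrite /h /attached_hex liftK. Qed.

Lemma attached_hex_inj : injective h.
Proof.
move=> i j; case: (unliftP ord0 i) => [i'|] ->; case: (unliftP ord0 j) => [j'|] ->;
  by rewrite ?attached_hex0 ?attached_hex_lift // => -[->].
Qed.

Lemma attach_rel_hex i j : sedge (h i) (h j) = hex_rel i j.
Proof.
case: (unliftP ord0 i) => [i'|] ->; case: (unliftP ord0 j) => [j'|] ->;
  by rewrite ?attached_hex0 ?attached_hex_lift /= ?eqxx // sedge_irr.
Qed.

Lemma edges_attach_hexagon : edges (attach_hexagon u) =
  [set (@inl G 'I_5) @: e | e : {set G} in edges G]
  :|: [set h @: e | e : {set hexagon} in edges hexagon].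
Proof.
apply/setP => e; rewrite in_setU; apply/idP/orP.
  rewrite inE => /existsP[x /existsP[y /andP[xy /eqP->]]].
  (* Every edge with an [inr] end belongs to the new hexagon, its possible old end [u] being
     [h ord0]. *)
  have hexP (i j : 'I_6) : x = h i -> y = h j ->
      [set x; y] \in [set h @: e | e : {set hexagon} in edges hexagon].
    move=> Ex Ey; rewrite Ex Ey -imset_set2 imset_f // inE.
    apply/existsP; exists i; apply/existsP; exists j.
    by move: xy; rewrite Ex Ey attach_rel_hex => ij; rewrite eqxx andbT.
  case: x y xy hexP => [x|i] [y|j] /= xy hexP.
  - left; rewrite -imset_set2 imset_f // inE.
    by apply/existsP; exists x; apply/existsP; exists y; rewrite xy eqxx.
  - right; apply: (hexP ord0 (lift ord0 j)); rewrite ?attached_hex0 ?attached_hex_lift //.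
    by case/andP: xy => /eqP->.
  - right; apply: (hexP (lift ord0 i) ord0); rewrite ?attached_hex0 ?attached_hex_lift //.
    by case/andP: xy => /eqP->.
  - right; apply: (hexP (lift ord0 i) (lift ord0 j)); rewrite ?attached_hex_lift //.
case=> /imsetP[e' + ->]; rewrite !inE => /existsP[x /existsP[y /andP[xy /eqP->]]].
  apply/existsP; exists (inl x); apply/existsP; exists (inl y).
  by rewrite imset_set2 eqxx andbT.
apply/existsP; exists (h x); apply/existsP; exists (h y).
by rewrite imset_set2 eqxx andbT attach_rel_hex.
Qed.

Lemma avoiding_matchings_attach (B : {set hexagon}) :
  avoiding_matchings (h @: B) =
  \sum_(N : {set {set hexagon}} | is_matching N && [disjoint B & cover N])
    (if (ord0 \in B) || (@ord0 5 \in cover N)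
     then avoiding_matchings [set u] else num_matchings G).
Proof.
apply: (@avoiding_matchings_wedge G hexagon (attach_hexagon u) (@inl G 'I_5) h u ord0).
- by move=> x y [].
- exact: attached_hex_inj.
- by rewrite attached_hex0.
- move=> x i; case: (unliftP ord0 i) => [i'|] ->; rewrite ?attached_hex0 ?attached_hex_lift //.
  by case.
- exact: edges_attach_hexagon.
Qed.

Lemma num_matchings_attach : num_matchings (attach_hexagon u) =
  8 * num_matchings G + 10 * avoiding_matchings [set u].
Proof.
rewrite num_matchings_avoiding0 -(imset0 h) avoiding_matchings_attach inE /=.
exact: (sum_hex_matching0 (fun b => if b then avoiding_matchings [set u] else num_matchings G)).
Qed.

(** As [p != ord0], the glued vertex is not itself forbidden: the trace on the new hexagon alone
    decides whether the rest must miss [u]. *)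
Lemma avoiding_matchings_attach1 (p : 'I_6) : p != ord0 ->
  avoiding_matchings [set h p] =
  nth 0 [:: 0; 5; 3; 4; 3; 5] p * num_matchings G +
  nth 0 [:: 0; 3; 5; 4; 5; 3] p * avoiding_matchings [set u].
Proof.
move=> p0; rewrite -imset_set1 avoiding_matchings_attach inE eq_sym (negPf p0) /=.
rewrite (sum_hex_matching1 p (fun b => if b then avoiding_matchings [set u] else num_matchings G)).
by case: p p0 => [[|[|[|[|[|[|?]]]]]] ?].
Qed.
End AttachHexagon.

Lemma num_matchings_hexagon : num_matchings hexagon = 18.
Proof.
by rewrite num_matchings_avoiding0 /avoiding_matchings -sum1dep_card
  (sum_hex_matching0 (fun=> 1)).
Qed.

Lemma avoiding_matchings_hexagon0 : avoiding_matchings [set ord0 : hexagon] = 8.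
Proof.
by rewrite /avoiding_matchings -sum1dep_card
  (sum_hex_matching1 ord0 (fun=> 1)).
Qed.

(** * Expected counts and their linear recurrence *)

Local Open Scope ring_scope.

(* The coefficient t in v' = (8 - t) m + t v, where m and v are the expected
   numbers of matchings of a chain and of those missing the next attachment
   vertex, and v' is the value of v after attaching one more hexagon. *)
Definition transfer_coef (R : realType) (a b c : R) : R :=
  3 * a + 5 * b + 4 * c.

Section Expectation.
Variables (R : realType) (a b c : R).
Hypothesis abc : a + b + c = 1.

(** The chain is fixed here; only the next choice is random, and its index [d] stands for the
    distance [d.+1]. *)
Definition expected_avoiding (C : chain) : R :=
  \sum_(d < 3) dist_prob a b c d * (avoiding_matchings [set last_hex C (inord d.+1)])%:R.

Local Notation t := (transfer_coef a b c).

Lemma sum3 (F : 'I_3 -> R) : \sum_(d < 3) F d = F (inord 0) + F (inord 1) + F (inord 2).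
Proof.
rewrite !big_ord_recl big_ord0 addr0 addrA.
by congr (F _ + F _ + F _); apply: val_inj; rewrite /= inordK.
Qed.

Lemma dist_probE (i : nat) : (i < 3)%N -> dist_prob a b c (inord i) = nth 0 [:: a; b; c] i.
Proof. by move=> i3; rewrite /dist_prob (tnth_nth 0) /= inordK. Qed.

Lemma num_matchings_extend (C : chain) (d : 'I_3) :
  (num_matchings (chain_graph (extend_at_dist C d)))%:R =
  8 * (num_matchings (chain_graph C))%:R
  + 10 * (avoiding_matchings [set last_hex C (inord d.+1)])%:R :> R.
Proof. by rewrite num_matchings_attach natrD !natrM. Qed.

(** Averaging 5 m + 3 m', 3 m + 5 m' and 4 m + 4 m' with weights a, b, c gives m' the coefficient t,
    and m the coefficient 8 - t because a + b + c = 1. The vertex [p] is arbitrary, so this also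
    covers the step from one hexagon to two. *)
Lemma expected_avoiding_extend (C : chain) (p : 'I_6) :
  expected_avoiding (extend C p) =
  (8 - t) * (num_matchings (chain_graph C))%:R
  + t * (avoiding_matchings [set last_hex C p])%:R.
Proof.
have inord_neq0 d : (d < 5)%N -> inord d.+1 != @ord0 5.
  by move=> d5; rewrite -val_eqE /= inordK.
rewrite /expected_avoiding sum3 !dist_probE //= !inordK //=.
rewrite !avoiding_matchings_attach1 ?inord_neq0 // !inordK //= !natrD.
rewrite /transfer_coef; have -> : c = 1 - a - b by rewrite -abc; ring.
ring.
Qed.

Lemma choices_prob_cons k (d : 'I_3) (w : k.-tuple 'I_3) :
  choices_prob a b c [tuple of d :: w] = dist_prob a b c d * choices_prob a b c w.
Proof.
rewrite /choices_prob big_ord_recl; congr (_ * _).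
by apply: eq_bigr => i _; rewrite tnthS.
Qed.

Variables (x y : R).
Hypotheses (xDy : x + y = 8 + t) (xMy : x * y = 18 * t - 80).

(** Here x and y are the roots of the characteristic polynomial of the matrix with rows (8, 10) and
    (8 - t, t), of trace 8 + t and determinant 18 t - 80. For each root z, the form (z - t) m + 10 v
    is a left eigenvector, hence is multiplied by z at each step; the difference of the two forms is
    (x - y) m. The induction peels off the first choice, so [C] must vary. *)
Lemma expected_extensions k (C : chain) :
  (x - y) * (\sum_(w : k.-tuple 'I_3) choices_prob a b c w *
    (num_matchings (chain_graph (foldl extend_at_dist C w)))%:R) =
  ((x - t) * (num_matchings (chain_graph C))%:R + 10 * expected_avoiding C) * x ^+ k
  - ((y - t) * (num_matchings (chain_graph C))%:R + 10 * expected_avoiding C) * y ^+ k.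
Proof.
elim: k C => [|k IHk] C.
  rewrite big_tuple0 /= /choices_prob big_ord0; ring.
rewrite big_tuple_cons.
rewrite (eq_bigr (fun d => dist_prob a b c d * (\sum_(w : k.-tuple 'I_3) choices_prob a b c w *
    (num_matchings (chain_graph (foldl extend_at_dist (extend_at_dist C d) w)))%:R))); last first.
  by move=> d _; rewrite mulr_sumr; apply: eq_bigr => w _; rewrite choices_prob_cons mulrA.
rewrite mulr_sumr; under eq_bigr => d _ do
  rewrite mulrCA IHk num_matchings_extend expected_avoiding_extend.
rewrite /expected_avoiding !sum3 !dist_probE //= !inordK //=.
move: (num_matchings _)%:R (avoiding_matchings _)%:R (avoiding_matchings _)%:R
  (avoiding_matchings _)%:R => m m3 m2 m1.
have qx : x * x = (8 + t) * x - (18 * t - 80) by rewrite -xDy -xMy; ring.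
have qy : y * y = (8 + t) * y - (18 * t - 80) by rewrite -xDy -xMy; ring.
(* The eigenvector relation, averaged over the choice of distance; [m1], [m2], [m3] count the
   matchings missing the vertex at distance one, two, three. *)
have step z : z * z = (8 + t) * z - (18 * t - 80) ->
   a * ((z - t) * (8 * m + 10 * m1) + 10 * ((8 - t) * m + t * m1))
 + b * ((z - t) * (8 * m + 10 * m2) + 10 * ((8 - t) * m + t * m2))
 + c * ((z - t) * (8 * m + 10 * m3) + 10 * ((8 - t) * m + t * m3))
 = ((z - t) * m + 10 * (a * m1 + b * m2 + c * m3)) * z.
  move=> qz; have -> : ((z - t) * m + 10 * (a * m1 + b * m2 + c * m3)) * z =
    m * (z * z) - t * m * z + 10 * (a * m1 + b * m2 + c * m3) * z by ring.
  rewrite qz /transfer_coef; have -> : c = 1 - a - b by rewrite -abc; ring.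
  ring.
rewrite !exprS !mulrA -(step x qx) -(step y qy); ring.
Qed.
End Expectation.

(* Closed form and asymptotics *)
From mathcomp Require Import all_classical all_reals all_analysis.
Import Order.TTheory GRing.Theory Num.Theory.
Import numFieldNormedType.Exports.
Local Open Scope classical_set_scope.
Local Open Scope ring_scope.

Definition dominant_root (R : realType) (a b c : R) : R :=
  (8 + transfer_coef a b c + sigma1 a b c) / 2.

Definition other_root (R : realType) (a b c : R) : R :=
  (8 + transfer_coef a b c - sigma1 a b c) / 2.

Section Asymptotics.
Variables (R : realType) (a b c : R).
Hypotheses (ha : 0 <= a) (hb : 0 <= b) (hc : 0 <= c) (habc : a + b + c = 1).

Local Notation t := (transfer_coef a b c).
Local Notation s := (sigma1 a b c).
Local Notation x := (dominant_root a b c).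
Local Notation y := (other_root a b c).

Lemma sigma1_radicand_gt0 :
  0 < 9 * a ^+ 2 + 30 * a * b + 24 * a * c + 152 * a + 25 * b ^+ 2
      + 40 * b * c + 40 * b + 16 * c ^+ 2 + 96 * c + 64.
Proof.
by rewrite ltr_wpDl // !addr_ge0 ?mulr_ge0 ?sqr_ge0.
Qed.

Lemma sigma1_gt0 : 0 < s.
Proof. by rewrite sqrtr_gt0 sigma1_radicand_gt0. Qed.

(** Once a + b + c = 1 is used, the radicand is the discriminant (8 + t)^2 - 4 (18 t - 80). *)
Lemma sigma1_sqr : s ^+ 2 = t ^+ 2 - 56 * t + 384.
Proof.
rewrite sqr_sqrtr; last exact/ltW/sigma1_radicand_gt0.
rewrite /transfer_coef; have -> : c = 1 - a - b by rewrite -habc; ring.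
ring.
Qed.

Lemma cactus_rootD : x + y = 8 + t. Proof. by rewrite /dominant_root /other_root; field. Qed.

Lemma cactus_rootM : x * y = 18 * t - 80.
Proof.
have -> : x * y = ((8 + t) ^+ 2 - s ^+ 2) / 4 by rewrite /dominant_root /other_root; field.
by rewrite sigma1_sqr; field.
Qed.

(** The recurrence is started at two hexagons, where [cactus] becomes a [foldl]; the counts 18 and 8
    for one hexagon supply the initial data. *)
Lemma expected_matchingsE k : s * expected_matchings a b c k.+2 =
  x ^+ k.+2 * (18 - y) - y ^+ k.+2 * (18 - x).
Proof.
have -> : expected_matchings a b c k.+2 = \sum_(w : k.-tuple 'I_3)
    choices_prob a b c w * (num_matchings (chain_graph
      (foldl extend_at_dist (extend chain1 ord0) w)))%:R.
  (* [k.+2 - 2] computes to [k - 0] and not to [k], so the tuple length on the right is adjusted. *)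
  by rewrite /expected_matchings /cactus -[k in RHS](subn0 k).
have -> : s = x - y by rewrite /dominant_root /other_root; field.
rewrite (expected_extensions habc cactus_rootD cactus_rootM).
rewrite expected_avoiding_extend // num_matchings_attach num_matchings_hexagon.
rewrite avoiding_matchings_hexagon0 natrD !natrM.
(* The right side is the eigenvector form at two hexagons. As x y = 18 t - 80, the left side at z =
   x is x^2 (18 - y), which turns the exponent k into k + 2; likewise for y. *)
have sq z : z * z = (8 + t) * z - (18 * t - 80) ->
    z * z * 18 - (18 * t - 80) * z =
    (z - t) * (8 * 18 + 10 * 8) + 10 * ((8 - t) * 18 + t * 8).
  by move=> ->; ring.
have qx : x * x = (8 + t) * x - (18 * t - 80).
  by rewrite -cactus_rootD -cactus_rootM; ring.
have qy : y * y = (8 + t) * y - (18 * t - 80).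
  by rewrite -cactus_rootD -cactus_rootM; ring.
rewrite -(sq x qx) -(sq y qy) -cactus_rootM !exprS; ring.
Qed.

Hypothesis hden : 13 * a - 5 * b + 4 * c != 0.

(** The stated formula is the dominant term in disguise: the fraction raised to the power n + 1 is 4
    / x, its companion factor is - 2 x y, and the bracket in the numerator is - 2 y (18 - y). *)
Lemma asymptotic_valueE n :
  asymptotic_value a b c n = x ^+ n * (18 - y) / s.
Proof.
have s_neq0 : s != 0 by rewrite gt_eqF // sigma1_gt0.
(* Thus [hden] says that neither root vanishes, which makes the cancellations legitimate. *)
have DE : 13 * a - 5 * b + 4 * c = - (x * y) / 2.
  rewrite cactus_rootM /transfer_coef; have -> : c = 1 - a - b by rewrite -habc; ring.
  by field.
have [x_neq0 y_neq0] : x != 0 /\ y != 0.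
  by move: hden; rewrite DE mulf_eq0 oppr_eq0 mulf_eq0 !negb_or -andbA => /and3P[].
rewrite /asymptotic_value.
have -> : - ((3 * a + 5 * b + 4 * c - s + 8) / (13 * a - 5 * b + 4 * c)) = 4 / x.
  rewrite DE (_ : 3 * a + 5 * b + 4 * c - s + 8 = 2 * y);
    last by rewrite /other_root /transfer_coef; field.
  by field; rewrite x_neq0.
have -> : 52 * a - 20 * b + 16 * c = - 2 * (x * y).
  have -> : 52 * a - 20 * b + 16 * c = 4 * (13 * a - 5 * b + 4 * c) by ring.
  by rewrite DE; field.
have -> : sigma2 a b c - 3 * a * s - 5 * b * s - 4 * c * s + 9 * a ^+ 2
    + 25 * b ^+ 2 + 16 * c ^+ 2 + 10 * s - 80 = - 2 * y * (18 - y).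
  have -> : - 2 * y * (18 - y) = (s ^+ 2 + (10 - t) * 2 * s + (8 + t) ^+ 2 - 36 * (8 + t)) / 2.
    by rewrite /other_root; field.
  rewrite sigma1_sqr /sigma2 /transfer_coef; have -> : c = 1 - a - b by rewrite -habc; ring.
  by field.
rewrite expr_div_n expr1n -exprVn !exprS expr_div_n !exprVn.
have e4 : (4 : R) ^+ n != 0 by rewrite expf_neq0 // pnatr_eq0.
have ex : x ^+ n != 0 by rewrite expf_neq0.
by field; rewrite ?s_neq0 ?x_neq0 ?y_neq0 ?e4 ?ex.
Qed.

End Asymptotics.

Theorem theorem4 (R : realType) (a b c : R)
    (ha : 0 <= a) (hb : 0 <= b) (hc : 0 <= c) (habc : a + b + c = 1)
    (hden : 13 * a - 5 * b + 4 * c != 0) :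
  (fun n : nat => expected_matchings a b c n / asymptotic_value a b c n)
    @ \oo --> (1 : R).
Proof.
have s_gt0 := sigma1_gt0 ha hb hc.
set s := sigma1 a b c in s_gt0.
pose t := transfer_coef a b c; pose x := dominant_root a b c; pose y := other_root a b c.
have t_ge0 : 0 <= t by rewrite /t /transfer_coef; lra.
have x_gt0 : 0 < x by rewrite /x /dominant_root -/s -/t; lra.
(* Both x - y = s and x + y = 8 + t are positive. *)
have xy : `|y| < x.
  rewrite ltr_norml /x /y /dominant_root /other_root -/s -/t.
  by apply/andP; split; lra.
(* Since t is at most 5, y is below 13 / 2; so the coefficient of the dominant power is nonzero. *)
have y18 : 0 < 18 - y by rewrite /y /other_root -/s /transfer_coef; lra.
have yx1 : `|y / x| < 1 by rewrite normrM normfV (gtr0_norm x_gt0) ltr_pdivrMr ?mul1r.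
(* The closed form is available from two hexagons on. There the ratio differs from 1 by a geometric
   sequence of ratio y / x. *)
rewrite -(cvg_shiftn 2) /=.
have -> : (fun n => expected_matchings a b c (n + 2) / asymptotic_value a b c (n + 2)) =
  (fun n => 1 - ((18 - x) / (18 - y) * (y / x) ^+ 2) * (y / x) ^+ n).
  apply/funext => n; rewrite addn2 asymptotic_valueE // -/s -/x -/y.
  have -> : expected_matchings a b c n.+2 =
      (x ^+ n.+2 * (18 - y) - y ^+ n.+2 * (18 - x)) / s.
    by rewrite -expected_matchingsE // mulrAC mulfV ?mul1r // gt_eqF.
  rewrite -[_ * _ ^+ 2 * _]mulrA -exprD add2n (expr_div_n y x).
  have ex : x ^+ n.+2 != 0 by rewrite expf_neq0 // gt_eqF.
  move: (x ^+ n.+2) ex (y ^+ n.+2) => X X_neq0 Y.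
  by field; rewrite X_neq0 !gt_eqF.
have := cvgB (cvg_cst (1 : R)) (cvg_geometric ((18 - x) / (18 - y) * (y / x) ^+ 2) yx1).
by rewrite subr0 => lim1; exact: lim1.
Qed.
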